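(* Suppose the graph $\mathcal{G} = (\mathcal{V},\mathcal{E})$ is connected, $\mathbf{Q} \in \mathbb{R}^{|\mathcal{E}| \times |\mathcal{V}|}$ is the incidence matrix of $\mathcal{G}$, and $T = \{\tau_1, \dots,\tau_d\}$ is a $(d,\alpha,\beta,r,R)$ row covering of $\mathbf{Q}$ with $\alpha>0$. Let $\mathbf{c}_0=\mathbf{c}\in\mathbb{R}^{|\mathcal{V}|}$ be the vector of initial node values and let $\mathbf{c}^*=\bar c\,\mathbf{1}$ where $\bar c$ is the mean of the entries of $\mathbf{c}$. Assume that the edge miscommunication vectors $\mathbf{m}_k\in\mathbb{R}^{|\mathcal{E}|}$ are sampled i.i.d. according to a distribution $\mathcal{D}$, independently of the block choices, with $\mathbb{E}_{\mathcal{D}}[\mathbf{m}_k]=\mathbf{0}$ and $\operatorname{cov}(\mathbf{m}_k)=\mathbb{E}_{\mathcal{D}}[\mathbf{m}_k\mathbf{m}_k^\top]=\mathbf{\Sigma}$. Let $\mathbf{c}_k$ be the iterates of the block gossip method under randomly varying edge miscommunication with blocks determined by $T$, i.e. $$\mathbf{c}_k = \mathbf{c}_{k-1} + \mathbf{Q}^\dagger_\tau\left((\mathbf{m}_k)_\tau - \mathbf{Q}_\tau\mathbf{c}_{k-1}\right),$$ where at each iteration $\tau$ is chosen uniformly at random from $T$, independently of previous choices. Then the method converges at least linearly in expectation to a horizon determined by $\operatorname{tr}(\mathbf{\Sigma})$, with the guarantee, for all $k\ge0$, $$\mathbb{E}\|\mathbf{c}_k - \mathbf{c}^*\|^2 \le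 \left(1 - \frac{r\,\alpha(\mathcal{G})}{\beta d}\right)^k \|\mathbf{c} - \mathbf{c}^*\|^2 + \frac{\beta R}{\alpha\, r\, \alpha(\mathcal{G})}\operatorname{tr}(\mathbf{\Sigma}),$$ where $\alpha(\mathcal{G})$ is the algebraic connectivity of $\mathcal{G}$.
   Context: $\mathcal{G}$ is a finite undirected graph. $[m]=\{1,\dots,m\}$, $\mathbf{1}$ is the all-ones vector, $\|\cdot\|$ is the Euclidean norm, $\dagger$ denotes the Moore–Penrose pseudoinverse, and $\mathbf{Q}_\tau$, $\mathbf{v}_\tau$ denote restriction to the rows (entries) indexed by $\tau$. The expectation is over both the block choices and the miscommunication vectors. Incidence matrix: each row of $\mathbf{Q}$ corresponds to an edge and each column to a node; the row of an edge joining nodes $i$ and $j$ has one of its $i$th and $j$th entries equal to $1$ and the other equal to $-1$ (order immaterial), all other entries zero. Row covering: a $(d,\alpha,\beta,r,R)$ row covering of a matrix $\mathbf{A}$ with $m$ rows is a collection $T=\{\tau_1,\dots,\tau_d\}$ of subsets of $[m]$ such that every $i \in [m]$ lies in some $\tau_l$, and $\alpha \le \lambda_{\min+}(\mathbf{A}_\tau\mathbf{A}_\tau^\top)$ and $\lambda_{\max}(\mathbf{A}_\tau\mathbf{A}_\tau^\top)\le\beta$ for each $\tau\in T$, where $\lambda_{\min+}$ and $\lambda_{\max}$ denote the smallest nonzero and the largest eigenvalue, and $r=\min_{i\in[m]}|\{\tau_l\in T: i\in\tau_l\}|$, $R=\max_{i\in[m]}|\{\tau_l\in T: i\in\tau_l\}|$.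 Algebraic connectivity $\alpha(\mathcal{G})$: the second smallest eigenvalue of the Laplacian $\mathbf{Q}^\top\mathbf{Q}$. (It is distinct from the covering parameter $\alpha$.) *)

(* Defs.v *)
From HB Require Import structures.
From mathcomp Require Import all_boot all_order all_algebra.
From mathcomp Require Import finmap.
From mathcomp Require Import all_classical all_reals all_analysis.

Set Implicit Arguments.
Unset Strict Implicit.
Unset Printing Implicit Defensive.

Import Order.TTheory GRing.Theory Num.Theory.
Local Open Scope classical_set_scope.
Local Open Scope ring_scope.

(* A finite undirected graph with nodes 'I_n and edges 'I_m.  Each edge has two
   distinct end nodes; parallel edges are allowed, and simple graphs are those
   for which [ends] is injective. *)
Record graph (m n : nat) := Graph {
  ends : 'I_m -> {set 'I_n};
  card_ends : forall e, #|ends e| = 2%N }.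

Definition adjacent_nodes m n (G : graph m n) : rel 'I_n :=
  fun i j => [exists e, ends G e == [set i; j]%SET].

Definition connected_graph m n (G : graph m n) : Prop :=
  forall i j, connect (adjacent_nodes G) i j.

(* The orientation i -> j of each edge is arbitrary. *)
Definition incidence_matrix (R : realType) m n (G : graph m n)
    (Q : 'M[R]_(m, n)) : Prop :=
  forall e : 'I_m, exists i j : 'I_n,
    ends G e = [set i; j]%SET /\
    forall v, Q e v = (v == i)%:R - (v == j)%:R.

Definition restrict_rows (R : realType) m p (t : {set 'I_m})
    (A : 'M[R]_(m, p)) : 'M[R]_(#|t|, p) :=
  rowsub (fun k : 'I_#|t| => enum_val k) A.

Definition is_pinv (R : realType) m n (A : 'M[R]_(m, n)) (X : 'M[R]_(n, m)) :=
  [/\ A *m X *m A = A, X *m A *m X = X,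
      (A *m X)^T = A *m X & (X *m A)^T = X *m A].

(* Moore-Penrose pseudoinverse: the unique solution of the Penrose equations,
   which exists for every real matrix, so the default 0 plays no role. *)
Definition pinv (R : realType) m n (A : 'M[R]_(m, n)) : 'M[R]_(n, m) :=
  xget 0 [set X | is_pinv A X].

(* The eigenvalues of M with multiplicity, in nondecreasing order.  The default
   [::] is used only if char_poly M does not split over R; every M below is
   symmetric, so that its characteristic polynomial splits. *)
Definition spectrum (R : realType) n (M : 'M[R]_n) : seq R :=
  xget [::] [set s | sorted <=%R s /\ char_poly M = \prod_(x <- s) ('X - x%:P)].

(* +oo if M has no nonzero eigenvalue *)
Definition lambda_min_pos (R : realType) n (M : 'M[R]_n) : \bar R :=
  \big[mine/+oo%E]_(x <- spectrum M | x != 0) x%:E.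

(* -oo if M is the empty matrix *)
Definition lambda_max (R : realType) n (M : 'M[R]_n) : \bar R :=
  \big[maxe/-oo%E]_(x <- spectrum M) x%:E.

(* The second smallest eigenvalue, counted with multiplicity, of the Laplacian
   of the graph with incidence matrix Q; 0 by default if there are fewer than
   two nodes. *)
Definition algebraic_connectivity (R : realType) m n (Q : 'M[R]_(m, n)) : R :=
  nth 0 (spectrum (Q^T *m Q)) 1.

Definition cover_count m d (tau : 'I_d -> {set 'I_m}) (i : 'I_m) : nat :=
  #|[set l | i \in tau l]%SET|.

(* cover_count is at most d, so starting from d yields the true minimum as soon
   as m > 0. *)
Definition row_covering (R : realType) m n (A : 'M[R]_(m, n)) d
    (alpha beta : R) (rmin rmax : nat) (tau : 'I_d -> {set 'I_m}) : Prop :=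
  [/\ forall i, exists l, i \in tau l,
      forall l, let At := restrict_rows (tau l) A in
        (alpha%:E <= lambda_min_pos (At *m At^T))%E /\
        (lambda_max (At *m At^T) <= beta%:E)%E,
      rmin = \big[minn/d]_(i < m) cover_count tau i &
      rmax = \max_(i < m) cover_count tau i].

Definition norm2 (R : realType) n (x : 'cV[R]_n) : R :=
  Num.sqrt (\sum_i x i 0 ^+ 2).

Definition mean_vector (R : realType) n (c : 'cV[R]_n) : 'cV[R]_n :=
  const_mx ((\sum_i c i 0) / n%:R).

Definition gossip_step (R : realType) m n (Q : 'M[R]_(m, n)) (t : {set 'I_m})
    (mk : 'cV[R]_m) (x : 'cV[R]_n) : 'cV[R]_n :=
  let Qt := restrict_rows t Q in
  x + pinv Qt *m (restrict_rows t mk - Qt *m x).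

(* [b k] and [mu k] are the block and the miscommunication vector that produce
   the iterate k.+1 from the iterate k. *)
Fixpoint block_gossip (R : realType) m n (Q : 'M[R]_(m, n))
    (b : nat -> {set 'I_m}) (mu : nat -> 'cV[R]_m) (c : 'cV[R]_n) (k : nat) :
    'cV[R]_n :=
  if k is k'.+1 then gossip_step Q (b k') (mu k') (block_gossip Q b mu c k')
  else c.

Definition col_of_tuple (R : realType) m (x : m.-tuple R) : 'cV[R]_m :=
  \col_i tnth x i.

(* Mutual independence of a family of set systems.  For sigma-algebras this is
   the independence of the random variables that generate them. *)
Definition mutually_independent (R : realType) (disp : measure_display)
    (Omega : measurableType disp) (P : probability Omega R) (I : choiceType)
    (F : I -> set (set Omega)) : Prop :=
  forall (J : {fset I}) (A : I -> set Omega),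
    (forall i, i \in J -> F i (A i)) ->
    P (\bigcap_(i in [set` J]) A i) = (\prod_(i <- J) P (A i))%E.

(* The sigma-algebras generated by the block choices, indexed by [inl k], and
   by the miscommunication vectors, indexed by [inr k]. *)
Definition choice_noise_sigma (R : realType) (disp : measure_display)
    (Omega : measurableType disp) (d m : nat) (blk : nat -> Omega -> 'I_d)
    (msg : nat -> Omega -> m.-tuple R) (i : nat + nat) : set (set Omega) :=
  match i with
  | inl k => preimage_set_system setT (blk k) setT
  | inr k => preimage_set_system setT (msg k) measurable
  end.

(* Main.v *)
Require Import Defs.
From HB Require Import structures.
From mathcomp Require Import all_boot all_order all_algebra all_fingroup.
From mathcomp Require Import complex.
From mathcomp Require Import finmap.
From mathcomp Require Import all_classical all_reals all_analysis.
From mathcomp Require Import measurable_realfun ring lra.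

(** Write [e_k = c_k - c*] for the error.  As [Q c* = 0], one step with block
    [t] reads [e' = (1 - P) e + Q_t^+ m_t], where [Q_t^+] is the pseudoinverse
    and [P = Q_t^+ Q_t] is the orthogonal projector on the row space of [Q_t].
    The two summands are orthogonal, so that Pythagoras gives, for every outcome
    and without any cross term,

      |e'|^2 = |e|^2 - |P e|^2 + |Q_t^+ m_t|^2.

    The spectral bounds of the covering turn this into
    [|e'|^2 + |Q_t e|^2 / beta <= |e|^2 + |m_t|^2 / alpha]
    ([projection_step_le]).

    The block is uniform and independent of the current error and of the current
    noise ([block_choice_indep_of_past], [block_choice_indep_of_noise]), so its
    choice averages out ([integral_uniform_choice]).  A row of [Q] lies in at
    least [rmin] and at most [rmax] of the [d] blocks, so the expectation of
    [|Q_t e|^2] is at least [rmin / d] times that of [|Q e|^2], and the one of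
    [|m_t|^2] is at most [rmax / d * tr Sigma].  A step changes the error inside
    the row space of [Q], which is orthogonal to the vector 1; hence every error
    is orthogonal to 1, and Courant-Fischer gives
    [|Q e|^2 >= algebraic_connectivity Q * |e|^2] ([algebraic_connectivity_le]).
    The expected squared errors [a_k] therefore satisfy
    [a_(k+1) <= (1 - s) a_k + t], with
    [s = rmin * algebraic_connectivity Q / (beta d)] and
    [t = rmax * tr Sigma / (alpha d)], and summing the geometric series gives the
    horizon [t / s].

    All spectral statements rest on the real spectral theorem
    ([symmetric_diagonalization]), in the form where the diagonal is the sorted
    spectrum ([spectrum_diagonalization]).  With fewer than two nodes there is no
    edge, and the iterates stay at the mean. *)

Set Implicit Arguments.
Unset Strict Implicit.
Unset Printing Implicit Defensive.

Import Order.TTheory GRing.Theory Num.Theory.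
Local Open Scope classical_set_scope.
Local Open Scope ring_scope.

(* The name pinv alone denotes the partial inverse of a function. *)
Local Notation pinv := Defs.pinv.

(** * Inner product of column vectors and the real spectral theorem *)

Definition dot (R : pzRingType) n (x y : 'cV[R]_n) : R := (x^T *m y) 0 0.

Section Dot.
Variables (R : realDomainType).
Implicit Types (m n : nat).

Lemma dotE n (x y : 'cV[R]_n) : dot x y = \sum_i x i 0 * y i 0.
Proof. by rewrite /dot mxE; apply: eq_bigr => i _; rewrite mxE. Qed.

Lemma dotC n (x y : 'cV[R]_n) : dot x y = dot y x.
Proof. by rewrite !dotE; apply: eq_bigr => i _; rewrite mulrC. Qed.

Lemma dotDl n (x y z : 'cV[R]_n) : dot (x + y) z = dot x z + dot y z.
Proof. by rewrite /dot linearD mulmxDl mxE. Qed.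

Lemma dotDr n (x y z : 'cV[R]_n) : dot x (y + z) = dot x y + dot x z.
Proof. by rewrite /dot mulmxDr mxE. Qed.

Lemma dotNl n (x y : 'cV[R]_n) : dot (- x) y = - dot x y.
Proof. by rewrite /dot linearN mulNmx mxE. Qed.

Lemma dotNr n (x y : 'cV[R]_n) : dot x (- y) = - dot x y.
Proof. by rewrite /dot mulmxN mxE. Qed.

Lemma dotZl n a (x y : 'cV[R]_n) : dot (a *: x) y = a * dot x y.
Proof. by rewrite /dot linearZ -scalemxAl mxE. Qed.

Lemma dotZr n a (x y : 'cV[R]_n) : dot x (a *: y) = a * dot x y.
Proof. by rewrite /dot -scalemxAr mxE. Qed.

Lemma dot0l n (x : 'cV[R]_n) : dot 0 x = 0.
Proof. by rewrite /dot trmx0 mul0mx mxE. Qed.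

Lemma dot_mulmxl m n (A : 'M[R]_(m, n)) x y :
  dot (A *m x) y = dot x (A^T *m y).
Proof. by rewrite /dot trmx_mul mulmxA. Qed.

Lemma dot_mulmxr m n (A : 'M[R]_(m, n)) x y :
  dot x (A *m y) = dot (A^T *m x) y.
Proof. by rewrite dot_mulmxl trmxK. Qed.

Lemma dotxx n (x : 'cV[R]_n) : dot x x = \sum_i x i 0 ^+ 2.
Proof. by rewrite dotE; apply: eq_bigr => i _; rewrite expr2. Qed.

Lemma dot_ge0 n (x : 'cV[R]_n) : 0 <= dot x x.
Proof. by rewrite dotxx; apply: sumr_ge0 => i _; exact: sqr_ge0. Qed.

Lemma dot_eq0 n (x : 'cV[R]_n) : (dot x x == 0) = (x == 0).
Proof.
rewrite dotxx psumr_eq0; last by move=> i _; exact: sqr_ge0.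
apply/allP/eqP => [h|-> i _]; last by rewrite mxE expr0n /= eqxx.
apply/colP => i; rewrite mxE; apply/eqP.
by have := h i (mem_index_enum _); rewrite sqrf_eq0.
Qed.

End Dot.

Section SpectralTheorem.
Variable R : rcfType.

(** Over [R[i]] the matrix is Hermitian, so its characteristic polynomial has a
    root, and that root is real. *)
Lemma symmetric_eigenvalue n (M : 'M[R]_n) : (0 < n)%N -> M^T = M ->
  exists a, eigenvalue M a.
Proof.
move=> n_gt0 Msym.
pose f : {rmorphism R -> complex R} := real_complex R.
pose N := map_mx f M.
have Nherm : N \is hermsymmx.
  apply: realsym_hermsym.
    apply/is_hermitianmxP; rewrite expr0 scale1r map_mx_id//.
    by rewrite /N map_trmx Msym.
  by apply/mxOverP => i j; rewrite mxE complex_real.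
have /hermitian_normalmx/orthomx_spectralP defN := Nherm.
have /mxOverP realD := hermitian_spectral_diag_real Nherm.
pose i0 := Ordinal n_gt0.
have /complex_realP[a aE] := realD 0 i0.
exists a; rewrite eigenvalue_root_char -(fmorph_root f) map_char_poly.
rewrite -/N -eigenvalue_root_char; apply/eigenvalueP.
set U := spectralmx N in defN; set D := spectral_diag N in defN aE.
have Uu : U \in unitmx by exact: spectral_unit.
exists (row i0 U).
  rewrite -row_mul defN !mulmxA mulmxV// mul1mx.
  apply/rowP => j; rewrite [LHS]mxE -/(row i0 _) mul_diag_mx !mxE.
  by rewrite aE.
apply/eqP => /(congr1 (mulmx^~ (invmx U))); rewrite mul0mx -row_mul mulmxV//.
by move/rowP/(_ i0)/eqP; rewrite !mxE eqxx oner_eq0.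
Qed.

(** The Householder reflection that exchanges [v] and the first basis vector. *)
Lemma orthogonal_with_first_row n (v : 'rV[R]_n.+1) : v *m v^T = 1%:M ->
  exists2 H : 'M[R]_n.+1, H *m H^T = 1%:M & row 0 H = v.
Proof.
move=> vv1.
pose e : 'rV[R]_n.+1 := delta_mx 0 0.
have [<-|ev] := eqVneq e v; first by exists 1%:M; rewrite ?trmx1 ?mulmx1 ?row1.
pose w := e - v; pose c := 1 - v 0 0.
have ee : e *m e^T = 1%:M.
  by rewrite trmx_delta mul_delta_mx; apply/matrixP=> i j; rewrite !ord1 !mxE.
have ve : v *m e^T = (v 0 0)%:M.
  apply/matrixP => i j; rewrite !ord1 trmx_delta -colE !mxE eqxx mulr1n.
  by [].
have ev' : e *m v^T = (v 0 0)%:M.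
  by rewrite -[LHS]trmxK trmx_mul trmxK ve tr_scalar_mx.
have ww : w *m w^T = (2 * c)%:M.
  rewrite /w linearB/= mulmxBl !mulmxBr ee ve ev' vv1.
  by apply/matrixP => i j; rewrite !ord1 !mxE /= !mulr1n /c; ring.
have c0 : c != 0.
  apply/eqP => c0; move: ww; rewrite c0 mulr0 => ww.
  have /eqP : dot w^T w^T = 0 by rewrite /dot trmxK ww !mxE mul0rn.
  rewrite dot_eq0 trmx_eq0 subr_eq0 => /eqP evE.
  by rewrite evE eqxx in ev.
pose H := 1%:M - c^-1 *: (w^T *m w).
have HT : H^T = H by rewrite /H linearB/= linearZ/= trmx1 trmx_mul trmxK.
exists H.
  have wwK : w^T *m w *m (w^T *m w) = (2 * c) *: (w^T *m w).
    by rewrite !mulmxA -[w^T *m w *m w^T]mulmxA ww mul_mx_scalar -scalemxAl.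
  rewrite HT /H; move: (w^T *m w) wwK => P PP.
  rewrite mulmxBl mul1mx -scalemxAl mulmxBr mulmx1 -scalemxAr PP.
  by apply/matrixP => i j; rewrite !mxE; field.
have -> : row 0 H = e - c^-1 *: (e *m w^T *m w).
  by rewrite rowE (mulmxBr e) mulmx1 -scalemxAr mulmxA.
have -> : e *m w^T = c%:M.
  by rewrite /w linearB/= mulmxBr ee ev' -raddfB.
by rewrite mul_scalar_mx scalerA mulVf// scale1r /w opprB addrC subrK.
Qed.

(** Deflation: in an orthonormal basis that starts with an eigenvector, the
    matrix is block diagonal with a symmetric block of smaller size. *)
Theorem symmetric_diagonalization n (M : 'M[R]_n) : M^T = M ->
  exists (U : 'M[R]_n) (d : 'rV[R]_n),
    U *m U^T = 1%:M /\ M = U^T *m diag_mx d *m U.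
Proof.
elim: n M => [|n IHn] M Msym.
  by exists 1%:M, 0; split; apply/matrixP => -[].
have [a /eigenvalueP[v vM v0]] := symmetric_eigenvalue (ltn0Sn n) Msym.
have vv : 0 < dot v^T v^T.
  by rewrite lt_def dot_ge0 dot_eq0 trmx_eq0 v0.
pose s := Num.sqrt (dot v^T v^T).
have s0 : s != 0 by rewrite gt_eqF// sqrtr_gt0.
pose u := s^-1 *: v.
have uu : u *m u^T = 1%:M.
  rewrite /u linearZ/= -scalemxAl -scalemxAr scalerA.
  apply/matrixP => i j; rewrite !ord1 mxE.
  have -> : (v *m v^T) 0 0 = s ^+ 2 by rewrite sqr_sqrtr ?ltW// /dot trmxK.
  by rewrite !mxE mulr1n; field.
have uM : u *m M = a *: u by rewrite -scalemxAl vM !scalerA mulrC.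
have [H HH Hrow] := orthogonal_with_first_row uu.
have HtH : H^T *m H = 1%:M by exact: mulmx1C.
pose B : 'M[R]_(1 + n) := H *m M *m H^T.
have Bsym : B^T = B by rewrite /B !trmx_mul trmxK Msym mulmxA.
have rowB : row 0 B = a *: delta_mx 0 0.
  rewrite /B !row_mul Hrow uM -scalemxAl -Hrow -row_mul HH.
  by rewrite row1.
have MB : M = H^T *m B *m H.
  by rewrite /B !mulmxA HtH mul1mx -mulmxA HtH mulmx1.
move: B Bsym rowB MB => B Bsym rowB MB.
have B0 (i j : 'I_(1 + n)) : i = 0%N :> nat -> B i j = a * (j == 0%N :> nat)%:R.
  move=> i0; have /rowP/(_ j) := rowB; rewrite !mxE eqxx /=.
  by rewrite (_ : i = 0)//; exact: ord_inj.
pose B' := drsubmx B.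
have B'sym : B'^T = B' by rewrite /B' trmx_drsub Bsym.
have BE : B = block_mx a%:M 0 0 B'.
  rewrite -[LHS](submxK B); congr block_mx.
  - apply/matrixP => i j; rewrite !ord1 !mxE.
    by rewrite B0 ?eqxx ?mulr1 ?mulr1n.
  - apply/matrixP => i j; rewrite !ord1 !mxE.
    by rewrite B0 ?mulr0.
  - apply/matrixP => i j; rewrite !ord1 !mxE -Bsym mxE.
    by rewrite B0 ?mulr0.
have [V [d [VV B'E]]] := IHn _ B'sym.
pose W : 'M[R]_(1 + n) := block_mx 1%:M 0 0 V.
have WW : W *m W^T = 1%:M.
  rewrite tr_block_mx mulmx_block !trmx0 trmx1 !mulmx0 !mul0mx !addr0 add0r.
  by rewrite VV mulmx1 -scalar_mx_block.
exists (W *m H), (row_mx a%:M d); split.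
  by rewrite trmx_mul mulmxA -[W *m H *m _]mulmxA HH mulmx1.
have dE : diag_mx (row_mx a%:M d : 'rV[R]_(1 + n)) =
    block_mx a%:M 0 0 (diag_mx d) :> 'M[R]_(1 + n).
  rewrite diag_mx_row; congr block_mx.
  by apply/matrixP => i j; rewrite !ord1 !mxE eqxx.
have WDW : B = W^T *m diag_mx (row_mx a%:M d) *m W.
  rewrite dE BE B'E tr_block_mx !mulmx_block !trmx0 trmx1.
  by rewrite !(mulmx0, mul0mx, addr0, add0r, mul1mx, mulmx1).
by rewrite {1}MB WDW trmx_mul !mulmxA.
Qed.

End SpectralTheorem.

(** * Spectrum of a real symmetric matrix and quadratic forms *)

Section Spectrum.
Variable R : realType.

Lemma orthogonal_congr_diagE n (U : 'M[R]_n) (d : 'rV[R]_n) a b :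
  (U^T *m diag_mx d *m U) a b = \sum_i d 0 i * (U i a * U i b).
Proof.
rewrite mxE; apply: eq_bigr => i _; rewrite mul_mx_diag !mxE; ring.
Qed.

Lemma char_poly_orthogonal_congr n (U M : 'M[R]_n) : U *m U^T = 1%:M ->
  char_poly (U^T *m M *m U) = char_poly M.
Proof.
move=> UU; have UtU := mulmx1C UU.
have UtUp : map_mx (@polyC R) U^T *m map_mx (@polyC R) U = 1%:M.
  by rewrite -map_mxM UtU map_mx1.
rewrite /char_poly.
have -> : char_poly_mx (U^T *m M *m U) =
    map_mx (@polyC R) U^T *m char_poly_mx M *m map_mx (@polyC R) U.
  rewrite /char_poly_mx !map_mxM mulmxBr mulmxBl mul_mx_scalar -scalemxAl UtUp.
  by rewrite scalemx1.
by rewrite !det_mulmx mulrAC -det_mulmx UtUp det1 mul1r.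
Qed.

Lemma spectrum_perm n (U : 'M[R]_n) (d : 'rV[R]_n) : U *m U^T = 1%:M ->
  sorted <=%R (spectrum (U^T *m diag_mx d *m U)) /\
  perm_eq (spectrum (U^T *m diag_mx d *m U)) [tuple d 0 i | i < n].
Proof.
move=> UU; set M := U^T *m _ *m U.
have charM : char_poly M = \prod_(x <- [tuple d 0 i | i < n]) ('X - x%:P).
  rewrite char_poly_orthogonal_congr// char_poly_trig; last first.
    exact/diag_mx_is_trig.
  rewrite big_map big_enum/=.
  by apply: eq_bigr => i _; rewrite mxE eqxx.
have : exists s : seq R,
    sorted <=%R s /\ char_poly M = \prod_(x <- s) ('X - x%:P).
  exists (sort <=%R [tuple d 0 i | i < n]); split.
    exact: sort_le_sorted.
  by rewrite charM; apply: perm_big; rewrite perm_sym perm_sort.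
move=> /(xgetPex [::])[sS cS].
by split=> //; apply: prod_XsubC_eq; rewrite -charM -cS.
Qed.

(** Unique factorization makes the spectrum a permutation of any diagonal form,
    and permuting the rows of [U] sorts the diagonal. *)
Theorem spectrum_diagonalization n (M : 'M[R]_n) : M^T = M ->
  exists U : 'M[R]_n,
    [/\ U *m U^T = 1%:M, M = U^T *m diag_mx (\row_i (spectrum M)`_i) *m U,
        sorted <=%R (spectrum M) & size (spectrum M) = n].
Proof.
move=> /symmetric_diagonalization[U [d [UU ME]]].
have [sS pS] := spectrum_perm d UU; rewrite -ME in sS pS.
have szS : size (spectrum M) = n by rewrite (perm_size pS) size_tuple.
have /tuple_permP[p pE] := pS.
exists (row_perm p U); split => //.
  by rewrite row_permE trmx_mul mulmxA -[perm_mx p *m U *m _]mulmxA UU mulmx1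
    tr_perm_mx -perm_mxM mulgV perm_mx1.
apply/matrixP => a b; rewrite orthogonal_congr_diagE [in LHS]ME.
rewrite orthogonal_congr_diagE (reindex_inj (@perm_inj _ p)) /=.
apply: eq_bigr => i _; rewrite !mxE pE.
by rewrite -tnth_nth !(tnth_map, tnth_ord_tuple).
Qed.

Lemma dot_orthogonal n (U : 'M[R]_n) (x y : 'cV[R]_n) : U *m U^T = 1%:M ->
  dot (U *m x) (U *m y) = dot x y.
Proof. by move=> /mulmx1C UU; rewrite dot_mulmxl mulmxA UU mul1mx. Qed.

Section Forms.
Variables (n : nat) (M U : 'M[R]_n) (s : 'I_n -> R).
Hypotheses (UU : U *m U^T = 1%:M).
Hypothesis (ME : M = U^T *m diag_mx (\row_i s i) *m U).

Lemma mulmx_eigenbasis (x : 'cV[R]_n) i : (U *m (M *m x)) i 0 = s i * (U *m x) i 0.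
Proof.
by rewrite ME !mulmxA UU mul1mx -mulmxA mul_diag_mx !mxE.
Qed.

Lemma dot_eigenbasis (x : 'cV[R]_n) : dot x x = \sum_i (U *m x) i 0 ^+ 2.
Proof. by rewrite -(dot_orthogonal x x UU) dotxx. Qed.

Lemma dot_mul_eigenbasis (x : 'cV[R]_n) : dot x (M *m x) = \sum_i s i * (U *m x) i 0 ^+ 2.
Proof.
rewrite -(dot_orthogonal _ _ UU) dotE; apply: eq_bigr => i _.
by rewrite mulmx_eigenbasis; ring.
Qed.

Lemma dot_mul2_eigenbasis (x : 'cV[R]_n) :
  dot (M *m x) (M *m x) = \sum_i s i ^+ 2 * (U *m x) i 0 ^+ 2.
Proof.
rewrite dot_eigenbasis; apply: eq_bigr => i _.
by rewrite mulmx_eigenbasis exprMn.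
Qed.
End Forms.

Lemma lambda_max_ge n (M : 'M[R]_n) (b : R) x :
  (lambda_max M <= b%:E)%E -> x \in spectrum M -> x <= b.
Proof.
rewrite /lambda_max; elim: (spectrum M) => [//|y s IHs].
rewrite big_cons ge_max lee_fin inE => /andP[yb /IHs h] /orP[/eqP->//|].
exact: h.
Qed.

Lemma lambda_min_pos_le n (M : 'M[R]_n) (a : R) x :
  (a%:E <= lambda_min_pos M)%E -> x \in spectrum M -> x != 0 -> a <= x.
Proof.
rewrite /lambda_min_pos; elim: (spectrum M) => [//|y s IHs].
rewrite big_cons inE => h /orP[/eqP->|xs] x0.
  by move: h; rewrite x0 le_min lee_fin => /andP[].
apply: IHs => //; move: h; case: ifP => // _.
by rewrite le_min => /andP[].
Qed.

Lemma dot_mul_le_lambda_max n (M : 'M[R]_n) b x : M^T = M ->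
  (lambda_max M <= b%:E)%E -> dot x (M *m x) <= b * dot x x.
Proof.
move=> /spectrum_diagonalization[U [UU ME _ szS]] Mb.
rewrite (dot_mul_eigenbasis UU ME) (dot_eigenbasis UU) mulr_sumr.
apply: ler_sum => i _; rewrite ler_wpM2r ?sqr_ge0//.
by apply: lambda_max_ge Mb _; rewrite mem_nth ?szS.
Qed.

(** In an eigenbasis this is [a s_i <= s_i ^ 2]: each eigenvalue is zero or at
    least [a]. *)
Lemma lambda_min_pos_le_dot_mul n (M : 'M[R]_n) a x : M^T = M -> 0 < a ->
  (forall y, 0 <= dot y (M *m y)) ->
  (a%:E <= lambda_min_pos M)%E ->
  a * dot x (M *m x) <= dot (M *m x) (M *m x).
Proof.
move=> /spectrum_diagonalization[U [UU ME _ szS]] a0 Mge0 Ma.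
rewrite (dot_mul2_eigenbasis UU ME) (dot_mul_eigenbasis UU ME) mulr_sumr.
apply: ler_sum => i _; rewrite mulrA ler_wpM2r ?sqr_ge0// expr2.
have [->|s0] := eqVneq (spectrum M)`_i 0; first by rewrite !mulr0.
have aS : a <= (spectrum M)`_i.
  by apply: lambda_min_pos_le Ma _ s0; rewrite mem_nth ?szS.
by rewrite ler_wpM2r// (le_trans (ltW a0)).
Qed.

Lemma gram_sym m n (A : 'M[R]_(m, n)) : (A *m A^T)^T = A *m A^T.
Proof. by rewrite trmx_mul trmxK. Qed.

(** The covering bounds [A A^T], but the bound is needed for [A^T A].  Expanding
    [0 <= |b x - A^T A x|^2] transfers it without comparing the two spectra. *)
Lemma dot_mulmx_le_lambda_max m n (A : 'M[R]_(m, n)) b x : 0 < b ->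
  (lambda_max (A *m A^T) <= b%:E)%E -> dot (A *m x) (A *m x) <= b * dot x x.
Proof.
move=> b0 Ab.
have := dot_mul_le_lambda_max (A *m x) (gram_sym A) Ab.
rewrite -(mulmxA A A^T) dot_mulmxr => h.
have := dot_ge0 (b *: x - A^T *m (A *m x)).
rewrite dotDl !dotDr !dotNl !dotNr !dotZl !dotZr opprK.
rewrite -[dot x (A^T *m _)]dot_mulmxl [dot (A^T *m _) x]dotC.
rewrite -[dot x (A^T *m _)]dot_mulmxl.
set p := dot x x in h *; set q := dot (A *m x) (A *m x) in h *.
set r := dot (A^T *m _) _ in h *.
move=> h2; have : b * q <= b * (b * p) by lra.
by rewrite ler_pM2l.
Qed.

End Spectrum.

(** * Pseudoinverse and one projection step *)

Section PseudoInverse.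
Variable R : realType.

Lemma mulmx_tr_eq0 m n (B : 'M[R]_(m, n)) : B^T *m B = 0 -> B = 0.
Proof.
move=> BB; apply/matrixP => i j; rewrite mxE.
suff : col j B == 0 by move=> /eqP/colP/(_ i); rewrite !mxE.
rewrite -dot_eq0.
have -> : dot (col j B) (col j B) = (B^T *m B) j j.
  by rewrite dotE mxE; apply: eq_bigr => k _; rewrite !mxE.
by rewrite BB mxE.
Qed.

(** With [L = A^T A = U^T diag(d) U], inverting the nonzero entries of [d] gives
    a symmetric [N] that commutes with [L], and [N A^T] is the pseudoinverse. *)
Lemma pinv_exists m n (A : 'M[R]_(m, n)) : exists X, is_pinv A X.
Proof.
have [L LA] : exists L, L = A^T *m A by exists (A^T *m A).
have Lsym : L^T = L by rewrite LA trmx_mul trmxK.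
have [U [d [UU LE]]] := symmetric_diagonalization Lsym.
pose N := U^T *m diag_mx (map_mx GRing.inv d) *m U.
have mulU (c1 c2 : 'rV[R]_n) :
    U^T *m diag_mx c1 *m U *m (U^T *m diag_mx c2 *m U) =
    U^T *m diag_mx (\row_i (c1 0 i * c2 0 i)) *m U.
  rewrite !mulmxA -[_ *m U *m U^T]mulmxA UU mulmx1 -[_ *m _ *m diag_mx c2]mulmxA.
  by rewrite mulmx_diag.
have trU (c1 : 'rV[R]_n) : (U^T *m diag_mx c1 *m U)^T = U^T *m diag_mx c1 *m U.
  by rewrite !trmx_mul trmxK tr_diag_mx mulmxA.
(* The inverse of a zero entry is 0, which is what the pseudoinverse needs. *)
have dVd i : d 0 i * (d 0 i)^-1 * d 0 i = d 0 i.
  by have [->|d0] := eqVneq (d 0 i) 0; rewrite ?mulr0// mulfV// mul1r.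
have VdV i : (d 0 i)^-1 * d 0 i * (d 0 i)^-1 = (d 0 i)^-1.
  by have [->|d0] := eqVneq (d 0 i) 0; rewrite ?invr0 ?mulr0// mulVf// mul1r.
have Nsym : N^T = N by exact: trU.
have LNL : L *m N *m L = L.
  rewrite LE !mulU; congr (_ *m diag_mx _ *m _).
  by apply/rowP => i; rewrite !mxE dVd.
have NLN : N *m L *m N = N.
  rewrite LE !mulU; congr (_ *m diag_mx _ *m _).
  by apply/rowP => i; rewrite !mxE VdV.
have NLsym : (N *m L)^T = N *m L by rewrite LE mulU trU.
have LN : L *m N = N *m L by rewrite -NLsym trmx_mul Lsym Nsym.
clearbody N; have ANL : A *m N *m L = A.
  apply/eqP; rewrite -subr_eq0; apply/eqP/mulmx_tr_eq0.
  have -> : A *m N *m L - A = A *m (N *m L - 1%:M).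
    by rewrite mulmxBr mulmx1 mulmxA.
  rewrite trmx_mul -mulmxA [A^T *m _]mulmxA -LA mulmxBr mulmx1 mulmxA LNL subrr.
  by rewrite mulmx0.
exists (N *m A^T); split.
- by rewrite -[RHS]ANL LA !mulmxA.
- by rewrite -[in RHS]NLN LA !mulmxA.
- by rewrite !trmx_mul trmxK Nsym mulmxA.
- by rewrite -mulmxA -LA.
Qed.

Lemma pinvP m n (A : 'M[R]_(m, n)) : is_pinv A (pinv A).
Proof. by have [X AX] := pinv_exists A; apply: (xgetPex 0); exists X. Qed.

Variables (m n : nat) (A : 'M[R]_(m, n)).

(** The residual of the projection on the row space is orthogonal to the range
    of the pseudoinverse, which is that row space. *)
Lemma dot_pinv_sub (x : 'cV[R]_n) (y : 'cV[R]_m) :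
  dot (x - pinv A *m (A *m x)) (pinv A *m y) = 0.
Proof.
have [_ XAX _ XAsym] := pinvP A.
have -> : pinv A *m y = (pinv A *m A) *m (pinv A *m y).
  by rewrite !mulmxA XAX.
rewrite dot_mulmxr XAsym mulmxBr.
by rewrite !mulmxA XAX subrr dot0l.
Qed.

(** The vector [z = pinv A *m y] is [A^T w] for some [w], so that
    [a |z|^2 <= |A A^T w|^2 = |A z|^2], and [A z] is an orthogonal projection of
    [y]. *)
Lemma dot_pinv_le (a : R) (y : 'cV[R]_m) : 0 < a ->
  (a%:E <= lambda_min_pos (A *m A^T))%E ->
  a * dot (pinv A *m y) (pinv A *m y) <= dot y y.
Proof.
move=> a0 Aa; have [AXA XAX AXsym XAsym] := pinvP A.
set X := pinv A in AXA XAX AXsym XAsym *.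
pose w := X^T *m (X *m y).
have wE : A^T *m w = X *m y.
  by rewrite /w mulmxA -trmx_mul XAsym !mulmxA XAX.
have := @lambda_min_pos_le_dot_mul _ _ (A *m A^T) a w (gram_sym A) a0.
have posA z : 0 <= dot z (A *m A^T *m z).
  by rewrite -mulmxA dot_mulmxr dot_ge0.
move=> /(_ posA Aa); rewrite -mulmxA wE dot_mulmxr wE.
move=> /le_trans; apply.
have := dot_ge0 (y - A *m (X *m y)).
rewrite dotDl !dotDr !dotNl !dotNr opprK [dot (A *m _) y]dotC.
have <- : dot y (A *m (X *m y)) = dot (A *m (X *m y)) (A *m (X *m y)).
  by rewrite [in RHS]mulmxA dot_mulmxl AXsym !mulmxA AXA.
lra.
Qed.

(** Pythagoras twice: [x' = (x - p) + q], where [p] and [q] lie in the row space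
    of [A] and [x - p] is orthogonal to it. *)
Lemma projection_step_le (a b : R) (x : 'cV[R]_n) (y : 'cV[R]_m) : 0 < a -> 0 < b ->
  (a%:E <= lambda_min_pos (A *m A^T))%E ->
  (lambda_max (A *m A^T) <= b%:E)%E ->
  forall x', x' = x + pinv A *m (y - A *m x) ->
  dot x' x' + b^-1 * dot (A *m x) (A *m x) <= dot x x + a^-1 * dot y y.
Proof.
move=> a0 b0 Aa Ab x' defx'.
have [AXA XAX _ XAsym] := pinvP A.
pose p := pinv A *m (A *m x); pose q := pinv A *m y.
have x'E : x' = (x - p) + q by rewrite defx' mulmxBr addrA addrAC.
have dx'E : dot x' x' = dot (x - p) (x - p) + dot q q.
  have pq := dot_pinv_sub x y; rewrite -/p -/q in pq.
  rewrite x'E; move: (x - p) pq => z zq.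
  by rewrite dotDl !dotDr [dot q z]dotC zq; ring.
have dxE : dot x x = dot (x - p) (x - p) + dot p p.
  have pp := dot_pinv_sub x (A *m x); rewrite -/p in pp.
  rewrite -[in LHS](subrK p x); move: (x - p) pp => z zq.
  by rewrite dotDl !dotDr [dot p z]dotC zq; ring.
have qy : dot q q <= a^-1 * dot y y.
  by rewrite ler_pdivlMl// dot_pinv_le.
have px : b^-1 * dot (A *m x) (A *m x) <= dot p p.
  rewrite ler_pdivrMl//.
  have -> : A *m x = A *m p by rewrite /p !mulmxA AXA.
  exact: dot_mulmx_le_lambda_max.
rewrite dx'E dxE; lra.
Qed.

(** The range of the pseudoinverse is the row space of [A]. *)
Lemma mul_pinv_orthogonal (y : 'cV[R]_m) (z : 'cV[R]_n) :
  A *m z = 0 -> dot z (pinv A *m y) = 0.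
Proof.
move=> Az; have [_ XAX _ XAsym] := pinvP A.
by rewrite -XAX -mulmxA dot_mulmxr XAsym -mulmxA Az mulmx0 dot0l.
Qed.

End PseudoInverse.

(** * Incidence matrix and algebraic connectivity *)

Section Graph.
Variables (R : realType) (m n : nat) (G : graph m n) (Q : 'M[R]_(m, n)).
Hypothesis hQ : incidence_matrix G Q.

Lemma incidence_mulE (v : 'cV[R]_n) e : exists i j : 'I_n,
  ends G e = [set i; j]%SET /\ (Q *m v) e 0 = v i 0 - v j 0.
Proof.
have [i [j [eij Qe]]] := hQ e; exists i, j; split => //.
rewrite mxE; under eq_bigr do rewrite Qe mulrBl.
rewrite sumrB; congr (_ - _).
  rewrite (bigD1 i)//= eqxx mul1r big1 ?addr0// => k /negPf ->.
  by rewrite mul0r.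
rewrite (bigD1 j)//= eqxx mul1r big1 ?addr0// => k /negPf ->.
by rewrite mul0r.
Qed.

Lemma incidence_mul_const a : Q *m (const_mx a : 'cV[R]_n) = 0.
Proof.
apply/colP => e; have [i [j [_ ->]]] := incidence_mulE (const_mx a) e.
by rewrite !mxE subrr.
Qed.

Lemma incidence_ker_const (v : 'cV[R]_n) i j : connected_graph G ->
  Q *m v = 0 -> v i 0 = v j 0.
Proof.
move=> /(_ i j)/connectP[p + ->] Qv0.
elim: p i => [//|k p IHp] i /= /andP[/existsP[e /eqP eE] /IHp <-].
have [a [b [eab]]] := incidence_mulE v e.
rewrite Qv0 mxE => /esym/eqP; rewrite subr_eq0 => /eqP vab.
have : i \in [set a; b]%SET by rewrite -eab eE !inE eqxx.
have : k \in [set a; b]%SET by rewrite -eab eE !inE eqxx orbT.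
by rewrite !inE => /orP[]/eqP-> /orP[]/eqP->.
Qed.

Lemma no_edge_on_one_node : (n <= 1)%N -> m = 0%N.
Proof.
case: m G => // m' G' n1; have := max_card (ends G' 0).
by rewrite card_ends card_ord => /leq_trans/(_ n1).
Qed.

Lemma laplacian_sym : (Q^T *m Q)^T = Q^T *m Q.
Proof. by rewrite trmx_mul trmxK. Qed.

Lemma dot_laplacian x : dot x (Q^T *m Q *m x) = dot (Q *m x) (Q *m x).
Proof. by rewrite -mulmxA dot_mulmxr trmxK. Qed.

(** The vector 1 is in the kernel of the Laplacian.  If the second eigenvalue is
    positive, then the kernel is one eigenline, and a vector orthogonal to 1 has
    no coordinate along it; otherwise the left-hand side is nonpositive. *)
Lemma algebraic_connectivity_le (x : 'cV[R]_n) : dot (const_mx 1) x = 0 ->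
  algebraic_connectivity Q * dot x x <= dot (Q *m x) (Q *m x).
Proof.
move=> x1; rewrite /algebraic_connectivity.
have [U [UU LE srt szS]] := spectrum_diagonalization laplacian_sym.
set s := spectrum _ in LE srt szS *.
have [s1_le0|s1_gt0] := leP s`_1 0.
  by rewrite (le_trans _ (dot_ge0 _))// mulr_le0_ge0 ?dot_ge0.
have n2 : (1 < n)%N.
  by rewrite -szS ltnNge; apply: contraTN s1_gt0 => /(nth_default 0) ->; rewrite ltxx.
pose i0 := Ordinal (ltnW n2).
have s1_le (i : 'I_n) : i != i0 -> s`_1 <= s`_i.
  rewrite -val_eqE /= -lt0n => i_gt0.
  by rewrite (sorted_leq_nth le_trans le_refl)// inE szS.
(* The eigenvalues outside i0 are positive, and Q maps 1 to 0. *)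
pose one : 'cV[R]_n := const_mx 1.
have Uone0 i : i != i0 -> (U *m one) i 0 = 0.
  move=> ii0; have := mulmx_eigenbasis UU LE one i.
  rewrite -mulmxA incidence_mul_const !mulmx0 mxE => /esym/eqP.
  by rewrite mulf_eq0 gt_eqF ?(lt_le_trans s1_gt0 (s1_le i ii0))//= => /eqP.
have dotUE y : dot one y = (U *m one) i0 0 * (U *m y) i0 0.
  rewrite -(dot_orthogonal one y UU) dotE (bigD1 i0)//= big1 ?addr0// => i ii0.
  by rewrite Uone0 ?mul0r.
have Ux0 : (U *m x) i0 0 = 0.
  have : dot one one != 0.
    rewrite dot_eq0; apply/eqP => /colP/(_ i0); rewrite !mxE => /eqP.
    by rewrite oner_eq0.
  rewrite dotUE mulf_eq0 orbb => /negPf U0.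
  by have /eqP := x1; rewrite dotUE mulf_eq0 U0/= => /eqP.
rewrite -dot_laplacian (dot_mul_eigenbasis UU LE) (dot_eigenbasis UU) mulr_sumr.
apply: ler_sum => i _; have [->|ii0] := eqVneq i i0.
  by rewrite Ux0 expr0n /= !mulr0.
by rewrite ler_wpM2r ?sqr_ge0 ?s1_le.
Qed.

(** On a connected graph the kernel of [Q] consists of the constant vectors, and
    two constant vectors that are not zero are not orthogonal. *)
Lemma algebraic_connectivity_gt0 : connected_graph G -> (1 < n)%N ->
  0 < algebraic_connectivity Q.
Proof.
move=> hG n2; rewrite /algebraic_connectivity.
have [U [UU LE srt szS]] := spectrum_diagonalization laplacian_sym.
set s := spectrum _ in LE srt szS *.
rewrite ltNge; apply/negP => s1_le0.
pose i0 := Ordinal (ltnW n2); pose i1 := Ordinal n2.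
(* If the second eigenvalue were nonpositive, v i0 and v i1 would be in the
   kernel. *)
pose v (i : 'I_n) : 'cV[R]_n := U^T *m delta_mx i 0.
have vdot i j : dot (v i) (v j) = (i == j)%:R.
  rewrite /v dot_mulmxl trmxK mulmxA UU mul1mx dotE (bigD1 i)//= big1 ?addr0.
    by rewrite !mxE !eqxx mul1r andbT.
  by move=> k /negPf ki; rewrite !mxE ki mul0r.
have vker (i : 'I_n) : s`_i <= 0 -> Q *m v i = 0.
  move=> si; apply/eqP; rewrite -dot_eq0 eq_le dot_ge0 andbT.
  rewrite -dot_laplacian (dot_mul_eigenbasis UU LE); apply: sumr_le0 => j _.
  rewrite /v mulmxA UU mul1mx mxE eqxx andbT.
  by have [->|] := eqVneq j i; rewrite ?expr1n ?mulr1// expr0n mulr0.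
have s0_le0 : s`_0 <= 0.
  apply: le_trans s1_le0.
  by rewrite (sorted_leq_nth le_trans le_refl)// inE szS ?(ltnW n2).
have const (i : 'I_n) j k : s`_i <= 0 -> v i j 0 = v i k 0.
  by move=> /vker/(incidence_ker_const j k hG).
have vE (i : 'I_n) : s`_i <= 0 -> v i i0 0 != 0.
  move=> si; apply/eqP => vi0.
  have : dot (v i) (v i) == 0.
    by rewrite dotE big1// => k _; rewrite (const i k i0)// vi0 mul0r.
  by rewrite vdot eqxx oner_eq0.
have : dot (v i0) (v i1) == 0 by rewrite vdot.
rewrite dotE.
under eq_bigr => k _ do rewrite (const i0 k i0)// (const i1 k i0)//.
rewrite sumr_const card_ord -mulr_natl !mulf_eq0 (negPf (vE i0 _))//.
rewrite (negPf (vE i1 _))// !orbF pnatr_eq0.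
by rewrite gtn_eqF ?(ltnW n2).
Qed.

End Graph.

(** * Row coverings and the gossip step *)

Section Blocks.
Variable R : realType.

Definition block_sq m (t : {set 'I_m}) (y : 'cV[R]_m) : R :=
  \sum_(i in t) y i 0 ^+ 2.

Lemma restrict_rows_mul m n p (t : {set 'I_m}) (A : 'M[R]_(m, n))
    (B : 'M[R]_(n, p)) :
  restrict_rows t A *m B = restrict_rows t (A *m B).
Proof.
by apply/matrixP => i j; rewrite !mxE; apply: eq_bigr => k _; rewrite !mxE.
Qed.

Lemma dot_restrict_rows m (t : {set 'I_m}) (y : 'cV[R]_m) :
  dot (restrict_rows t y) (restrict_rows t y) = block_sq t y.
Proof.
rewrite dotxx /block_sq [RHS]big_enum_val.
by apply: eq_bigr => i _; rewrite mxE.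
Qed.

Lemma block_sq_ge0 m (t : {set 'I_m}) y : 0 <= block_sq t y.
Proof. by apply: sumr_ge0 => i _; exact: sqr_ge0. Qed.

Lemma sum_block_sq m d (tau : 'I_d -> {set 'I_m}) y :
  \sum_l block_sq (tau l) y = \sum_i (cover_count tau i)%:R * y i 0 ^+ 2.
Proof.
rewrite /block_sq (exchange_big_dep xpredT)//=; apply: eq_bigr => i _.
rewrite sumr_const mulr_natl /cover_count; congr (_ *+ _).
by apply: eq_card => l; rewrite !inE.
Qed.

Lemma lambda_max_gt0 m n (A : 'M[R]_(m, n)) b i j : A i j != 0 ->
  (lambda_max (A *m A^T) <= b%:E)%E -> 0 < b.
Proof.
move=> Aij Ab; pose x : 'cV[R]_m := delta_mx i 0.
have := dot_mul_le_lambda_max x (gram_sym A) Ab.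
have -> : dot x x = 1.
  rewrite dotE (bigD1 i)//= big1 ?addr0 => [|k /negPf ki].
    by rewrite !mxE !eqxx mulr1.
  by rewrite !mxE ki mul0r.
rewrite mulr1; apply: lt_le_trans.
rewrite -mulmxA dot_mulmxr lt_def dot_ge0 andbT dot_eq0.
apply/eqP => /colP/(_ j); rewrite /x -colE !mxE => /eqP.
by rewrite (negPf Aij).
Qed.

Lemma bigminn_le (I : eqType) (r : seq I) (F : I -> nat) d i : i \in r ->
  (\big[minn/d]_(j <- r) F j <= F i)%N.
Proof.
elim: r => // k r IHr; rewrite inE big_cons => /orP[/eqP->|/IHr h].
  exact: geq_minl.
exact: leq_trans (geq_minr _ _) h.
Qed.

End Blocks.

Section Covering.
Variables (R : realType) (m n : nat) (A : 'M[R]_(m, n)) (d : nat).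
Variables (alpha beta : R) (rmin rmax : nat) (tau : 'I_d -> {set 'I_m}).
Hypothesis hT : row_covering A alpha beta rmin rmax tau.

Lemma sum_block_sq_ge (y : 'cV[R]_m) : rmin%:R * dot y y <= \sum_l block_sq (tau l) y.
Proof.
have [_ _ -> _] := hT.
rewrite sum_block_sq dotxx mulr_sumr; apply: ler_sum => i _.
by rewrite ler_wpM2r ?sqr_ge0// ler_nat bigminn_le// mem_index_enum.
Qed.

Lemma sum_block_weight_le (w : 'I_m -> R) : (forall i, 0 <= w i) ->
  \sum_l \sum_(i in tau l) w i <= rmax%:R * \sum_i w i.
Proof.
move=> w0; have [_ _ _ ->] := hT.
rewrite (exchange_big_dep xpredT)//= mulr_sumr; apply: ler_sum => i _.
rewrite sumr_const -[leLHS]mulr_natl ler_wpM2r// ler_nat.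
apply: leq_trans (leq_bigmax i); rewrite /cover_count.
by apply: eq_leq; apply: eq_card => l; rewrite !inE.
Qed.

Lemma covering_rmin_gt0 (i : 'I_m) : (0 < rmin)%N.
Proof.
have [cov _ -> _] := hT.
apply: (big_ind (fun x => 0 < x)%N).
- by have [l _] := cov i; exact: leq_ltn_trans (ltn_ord l).
- by move=> x y x0 y0; rewrite leq_min x0.
- move=> j _; rewrite card_gt0; apply/set0Pn.
  by have [l] := cov j; exists l; rewrite inE.
Qed.

Lemma covering_size_gt0 (i : 'I_m) : (0 < d)%N.
Proof.
by have [cov _ _ _] := hT; have [l _] := cov i; exact: leq_ltn_trans (ltn_ord l).
Qed.

Lemma covering_beta_gt0 i j : A i j != 0 -> 0 < beta.
Proof.
move=> Aij; have [cov lam _ _] := hT; have [l il] := cov i.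
have [_ +] := lam l; apply: (lambda_max_gt0 (i := enum_rank_in il i) (j := j)).
by rewrite mxE enum_rankK_in.
Qed.

Lemma sum_block_sq_le (x : 'cV[R]_n) : 0 < beta ->
  \sum_l block_sq (tau l) (A *m x) <= d%:R * beta * dot x x.
Proof.
move=> b0; have [_ lam _ _] := hT.
rewrite -mulrA mulr_natl -[d in _ *+ d]card_ord -sumr_const.
apply: ler_sum => l _.
rewrite -dot_restrict_rows -restrict_rows_mul.
by apply: dot_mulmx_le_lambda_max => //; have [] := lam l.
Qed.

(** Relative to a vector [z] of the kernel of [A], a gossip step is a step of the
    projection method; moreover it moves inside the row space of [A], and thus
    preserves the coordinates along the kernel. *)
Lemma gossip_step_le l (mk : 'cV[R]_m) (x z : 'cV[R]_n) :
  0 < alpha -> 0 < beta -> A *m z = 0 ->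
  let x' := gossip_step A (tau l) mk x in
  (dot (x' - z) (x' - z) + beta^-1 * block_sq (tau l) (A *m (x - z)) <=
   dot (x - z) (x - z) + alpha^-1 * block_sq (tau l) mk) /\
  (forall u : 'cV[R]_n, A *m u = 0 -> dot u (x' - z) = dot u (x - z)).
Proof.
move=> a0 b0 Az x'; have [_ /(_ l)[la lb] _ _] := hT.
have x'E : x' - z = (x - z) + pinv (restrict_rows (tau l) A) *m
    (restrict_rows (tau l) mk - restrict_rows (tau l) A *m (x - z)).
  have -> : restrict_rows (tau l) A *m (x - z) = restrict_rows (tau l) A *m x.
    by rewrite !restrict_rows_mul mulmxBr Az subr0.
  by rewrite /x' /gossip_step addrAC.
split.
  rewrite -!dot_restrict_rows -restrict_rows_mul.
  exact: projection_step_le.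
move=> u Au; rewrite x'E dotDr mul_pinv_orthogonal ?addr0//.
rewrite restrict_rows_mul Au; apply/colP => i; by rewrite !mxE.
Qed.

End Covering.

Section Rate.
Variables (R : realType) (m n : nat) (G : graph m n) (Q : 'M[R]_(m, n)).
Variables (d : nat) (alpha beta : R) (rmin rmax : nat).
Variable (tau : 'I_d -> {set 'I_m}).
Hypotheses (hG : connected_graph G) (hQ : incidence_matrix G Q).
Hypothesis hT : row_covering Q alpha beta rmin rmax tau.
Hypothesis n2 : (1 < n)%N.

Lemma connected_edge : exists e i, Q e i != 0.
Proof.
have [[e [i Qei]]|noQ] := pselect (exists e i, Q e i != 0).
  by exists e, i.
have Q0 : Q = 0.
  apply/matrixP => e i; rewrite mxE; apply/eqP/negPn/negP => Qei.
  by apply: noQ; exists e, i.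
pose i0 := Ordinal (ltnW n2); pose i1 := Ordinal n2.
have := incidence_ker_const hQ (v := delta_mx i0 0) i0 i1 hG.
rewrite Q0 mul0mx => /(_ erefl)/eqP; rewrite !mxE !eqxx /=.
by rewrite oner_eq0.
Qed.

Lemma covering_params_gt0 : [/\ 0 < beta, (0 < d)%N & (0 < rmin)%N].
Proof.
have [e [i Qei]] := connected_edge; split.
- exact: covering_beta_gt0 hT _ _ Qei.
- exact: covering_size_gt0 hT e.
- exact: covering_rmin_gt0 hT e.
Qed.

(** Nonnegativity of the rate is tested on the difference of two basis vectors,
    which is orthogonal to 1:
    [rmin * lambda_2 |x|^2 <= rmin |Q x|^2 <= sum_l |Q_l x|^2 <= d beta |x|^2]. *)
Lemma rate_bounds :
  0 <= 1 - rmin%:R * algebraic_connectivity Q / (beta * d%:R) < 1.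
Proof.
have [b0 d0 r0] := covering_params_gt0.
have L0 := algebraic_connectivity_gt0 hQ hG n2.
have bd0 : 0 < beta * d%:R by rewrite mulr_gt0// ltr0n.
rewrite subr_ge0 gtrBl divr_gt0 ?mulr_gt0 ?ltr0n// andbT.
rewrite ler_pdivrMr// mul1r.
pose i0 := Ordinal (ltnW n2); pose i1 := Ordinal n2.
pose x : 'cV[R]_n := delta_mx i0 0 - delta_mx i1 0.
have one_delta i : dot (const_mx 1) (delta_mx i 0 : 'cV[R]_n) = 1.
  rewrite dotE (bigD1 i)//= big1 ?addr0 => [|k /negPf ki].
    by rewrite !mxE !eqxx mulr1.
  by rewrite !mxE ki mulr0.
have x1 : dot (const_mx 1) x = 0 by rewrite dotDr dotNr !one_delta subrr.
have xx : 0 < dot x x.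
  rewrite lt_def dot_ge0 andbT dot_eq0 subr_eq0.
  apply/eqP => /colP/(_ i0); rewrite !mxE !eqxx /= => /eqP.
  by rewrite oner_eq0.
rewrite -(ler_pM2r xx) -mulrA.
apply: (@le_trans _ _ (rmin%:R * dot (Q *m x) (Q *m x))).
  by rewrite ler_wpM2l ?ler0n ?(algebraic_connectivity_le hQ).
apply: le_trans (sum_block_sq_ge hT _) _.
by rewrite [beta * _]mulrC (sum_block_sq_le hT).
Qed.

End Rate.

(** * Independence *)

Section Independence.
Variables (R : realType) (disp : measure_display) (T : measurableType disp).
Variable P : probability T R.

(** A system closed under intersection that generates the join of the
    sigma-algebras [F i] with [i] in [J]; independence is given on its members. *)
Definition cylinders (I : choiceType) (F : I -> set (set T)) (J : {fset I}) :
    set (set T) :=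
  [set A | exists2 E : I -> set T, (forall i, F i (E i)) &
     A = \bigcap_(i in [set` J]) E i].

Variables (I : choiceType) (F : I -> set (set T)).
Hypothesis FT : forall i, F i setT.

Lemma sub_cylinders (J : {fset I}) i A : i \in J -> F i A -> cylinders F J A.
Proof.
move=> iJ FA; exists (fun j => if j == i then A else setT).
  by move=> j; case: eqP => [->|_].
apply/seteqP; split => x /=.
  by move=> Ax j _ /=; case: ifP.
by move=> /(_ i iJ) /=; rewrite eqxx.
Qed.

Hypothesis Fm : forall i, F i `<=` measurable.
Hypothesis FI : forall i, setI_closed (F i).
Hypothesis indep : mutually_independent P F.

(** The finite measures [A |-> P (A :&: B)] and [A |-> P A * P B] agree on the
    generating cylinders, hence on the sigma-algebra (pi-lambda theorem). *)
Lemma mutually_independent_sigma (J : {fset I}) i B A :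
  i \notin J -> F i B -> <<s cylinders F J >> A ->
  P (A `&` B) = (P A * P B)%E.
Proof.
move=> iJ FB sA; have mB := Fm FB.
have PB : (fine (P B))%:E = P B by rewrite fineK// fin_num_measure.
have PB0 : 0 <= fine (P B) by rewrite fine_ge0.
rewrite muleC -PB -[RHS]/(mscale (NngNum PB0) P A) -[LHS]/(mrestr P mB A).
apply: (g_sigma_algebra_measure_unique (cylinders F J) _ (fun=> setT)) => //.
- move=> _ [E FE ->]; apply: fin_bigcap_measurable => // j _.
  exact: Fm.
- move=> _; exists (fun=> setT); first by [].
  by apply/seteqP; split.
- by rewrite bigcup_const//; exists 0%N.
- move=> _ _ [E1 FE1 ->] [E2 FE2 ->]; exists (fun j => E1 j `&` E2 j).
    by move=> j; exact: FI.
  by rewrite bigcapI.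
- move=> _ [E FE ->]; rewrite -[LHS]/(P (_ `&` B)).
  rewrite -[RHS]/((fine (P B))%:E * P _)%E PB muleC.
  pose E' j := if j == i then B else E j.
  have FE' j : F j (E' j) by rewrite /E'; case: eqP => [->|_].
  have E'i : E' i = B by rewrite /E' eqxx.
  have EE' j : j \in J -> E' j = E j.
    by rewrite /E'; case: eqP => // -> iJ'; rewrite iJ' in iJ.
  have -> : \bigcap_(j in [set` J]) E j `&` B =
      \bigcap_(j in [set` (i |` J)%fset]) E' j.
    apply/seteqP; split => x.
      move=> [Ex Bx] j /=; rewrite !inE /E' => /orP[/eqP->|jJ].
        by rewrite eqxx.
      by case: eqP => // _; exact: Ex.
    move=> E'x; split.
      by move=> j jJ; rewrite -EE'//; apply: E'x; rewrite /= !inE jJ orbT.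
    by rewrite -E'i; apply: E'x; exact: fset1U1.
  have -> : \bigcap_(j in [set` J]) E j = \bigcap_(j in [set` J]) E' j.
    by apply: eq_bigcapr => j jJ; rewrite EE'.
  rewrite !indep//; rewrite big_fsetU1//= E'i muleC; congr (_ * _)%E.
- move=> _ /=; rewrite /mrestr setTI.
  by rewrite -ge0_fin_numE ?fin_num_measure.
Qed.

(** On the positive half-line, the law of [f * \1_B] is [P B] times the law of
    [f], and zero values do not contribute to the integrals. *)
Lemma integral_mul_indic_indep (f : T -> R) B :
  measurable B -> measurable_fun setT f -> (forall w, 0 <= f w) ->
  (forall A : set R, measurable A -> P (f @^-1` A `&` B) = (P (f @^-1` A) * P B)%E) ->
  (\int[P]_w (f w * \1_B w)%:E = P B * \int[P]_w (f w)%:E)%E.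
Proof.
move=> mB mf f0 fB.
have PB : (fine (P B))%:E = P B by rewrite fineK// fin_num_measure.
have PB0 : 0 <= fine (P B) by rewrite fine_ge0.
pose g w := f w * \1_B w.
have mg : measurable_fun setT g.
  by apply: measurable_funM => //; exact: measurable_indic.
have g0 w : 0 <= g w by rewrite mulr_ge0.
(* The two laws may have different masses at 0, which D leaves out. *)
pose D := [set y : R | 0 < y].
have mD : measurable D.
  rewrite (_ : D = `]0, +oo[%classic); first exact: measurable_itv.
  by apply/seteqP; split => y /=; rewrite in_itv/= andbT.
have mEF : measurable_fun D (fun y : R => y%:E).
  by apply/measurable_EFinP; exact: measurable_id.
have restr (h : T -> R) : measurable_fun setT h -> (forall w, 0 <= h w) ->
    (\int[P]_w (h w)%:E = \int[pushforward P h]_(y in D) y%:E)%E.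
  move=> mh h0; rewrite ge0_integral_pushforward//; last first.
    by move=> y /[!inE] y0; rewrite lee_fin ltW.
  rewrite integral_mkcond [RHS]integral_mkcond; apply: eq_integral => w _.
  rewrite !patchE mem_setT; case: ifPn => // /negP; rewrite inE /= => hw.
  by congr _%:E; apply/eqP; rewrite eq_le h0 andbT leNgt; exact/negP.
pose fX : {mfun T >-> R} := HB.pack f (isMeasurableFun.Build _ _ _ _ f mf).
pose gX : {mfun T >-> R} := HB.pack g (isMeasurableFun.Build _ _ _ _ g mg).
rewrite -/g (restr _ mg g0) (restr _ mf f0) -PB.
have := @ge0_integral_mscale _ R R (pushforward P fX) D mD
  (NngNum PB0) (fun y : R => y%:E) mEF.
move=> /= <-; last by move=> y y0; rewrite lee_fin ltW.
apply: (@eq_measure_integral _ _ _ _ _ (pushforward P gX)) => A mA AD.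
rewrite -[LHS]/(P (g @^-1` A)) -[RHS]/((fine (P B))%:E * P (f @^-1` A))%E.
rewrite PB muleC -fB//; congr (P _).
apply/seteqP; split => w /=; rewrite /g indicE.
  move=> gA; have := AD _ gA; have [Bw|nBw] := pselect (B w).
    by move: gA; rewrite mem_set// mulr1.
  by rewrite memNset// mulr0 /D /= ltxx.
by move=> [fA Bw]; rewrite mem_set// mulr1.
Qed.

End Independence.

(** * Measurability of the iterates and independence of the next block *)

Section Measurability.
Variables (R : realType) (disp : measure_display) (T : measurableType disp).

Definition measurable_col m (X : T -> 'cV[R]_m) :=
  forall i, measurable_fun setT (fun w => X w i 0).

Lemma measurable_colD m (X Y : T -> 'cV[R]_m) :
  measurable_col X -> measurable_col Y -> measurable_col (fun w => X w + Y w).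
Proof.
move=> mX mY i; under eq_fun do rewrite mxE.
exact: measurable_funD.
Qed.

Lemma measurable_colN m (X : T -> 'cV[R]_m) :
  measurable_col X -> measurable_col (fun w => - X w).
Proof.
move=> mX i; under eq_fun do rewrite mxE.
exact: measurable_funN.
Qed.

Lemma measurable_col_cst m (x : 'cV[R]_m) : measurable_col (fun=> x).
Proof. by move=> i; exact: measurable_cst. Qed.

Lemma measurable_col_mul m n (A : 'M[R]_(m, n)) (X : T -> 'cV[R]_n) :
  measurable_col X -> measurable_col (fun w => A *m X w).
Proof.
move=> mX i; under eq_fun do rewrite mxE.
apply: measurable_sum => j; apply: measurable_funM; last exact: mX.
exact: measurable_cst.
Qed.

Lemma measurable_col_restrict m (t : {set 'I_m}) (X : T -> 'cV[R]_m) :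
  measurable_col X -> measurable_col (fun w => restrict_rows t (X w)).
Proof. by move=> mX i; under eq_fun do rewrite mxE; exact: mX. Qed.

Lemma measurable_block_sq m (t : {set 'I_m}) (X : T -> 'cV[R]_m) :
  measurable_col X -> measurable_fun setT (fun w => block_sq t (X w)).
Proof.
move=> mX; rewrite /block_sq; under eq_fun do rewrite -big_filter.
by apply: measurable_sum => i; apply: measurable_funX; exact: mX.
Qed.

Lemma measurable_dot m (X : T -> 'cV[R]_m) :
  measurable_col X -> measurable_fun setT (fun w => dot (X w) (X w)).
Proof.
move=> mX; under eq_fun do rewrite dotxx.
by apply: measurable_sum => i; apply: measurable_funX; exact: mX.
Qed.

Lemma select_sum_indic d (b : T -> 'I_d) (f : 'I_d -> T -> R) w :
  f (b w) w = \sum_l f l w * \1_(b @^-1` [set l]) w.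
Proof.
rewrite (bigD1 (b w))//= indicE mem_set// mulr1 big1 ?addr0// => l lb.
by rewrite indicE memNset ?mulr0//= => bl; rewrite bl eqxx in lb.
Qed.

Lemma measurable_select d (b : T -> 'I_d) (f : 'I_d -> T -> R) :
  (forall l, measurable (b @^-1` [set l])) ->
  (forall l, measurable_fun setT (f l)) ->
  measurable_fun setT (fun w => f (b w) w).
Proof.
move=> mb mf; under eq_fun do rewrite select_sum_indic.
by apply: measurable_sum => l; apply: measurable_funM.
Qed.

(** Stated on an arbitrary measurable space, so that it applies both to the
    sample space and to its coarser sigma-algebra of the first [K] steps. *)
Lemma measurable_block_gossip m n d (A : 'M[R]_(m, n))
    (tau : 'I_d -> {set 'I_m}) (blk : nat -> T -> 'I_d)
    (mu : nat -> T -> 'cV[R]_m) c K :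
  (forall j l, (j < K)%N -> measurable (blk j @^-1` [set l])) ->
  (forall j, (j < K)%N -> measurable_col (mu j)) ->
  measurable_col
    (fun w => block_gossip A (fun j => tau (blk j w)) (fun j => mu j w) c K).
Proof.
elim: K => [|K IHK] mblk mmu; first exact: measurable_col_cst.
have mX := IHK (fun j l jK => mblk j l (ltnW jK)) (fun j jK => mmu j (ltnW jK)).
move=> i /=; pose X w := block_gossip A (fun j => tau (blk j w)) (mu^~ w) c K.
apply: (@measurable_select d (blk K)
  (fun l w => gossip_step A (tau l) (mu K w) (X w) i 0)).
  by move=> l; exact: mblk.
move=> l; rewrite /gossip_step; move: i.
apply: measurable_colD => //; apply: measurable_col_mul.
apply: measurable_colD; first exact/measurable_col_restrict/mmu.
by apply: measurable_colN; exact: measurable_col_mul.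
Qed.

End Measurability.

Section UniformChoice.
Variables (R : realType) (disp : measure_display) (T : measurableType disp).
Variables (P : probability T R) (d : nat) (b : T -> 'I_d).
Hypothesis b_meas : forall l, measurable (b @^-1` [set l]).
Hypothesis b_unif : forall l, P (b @^-1` [set l]) = (d%:R^-1)%:E.

(** The integrand is the sum of the [f l] times the indicators of the events
    [b = l], and each product is integrated by independence. *)
Lemma integral_uniform_choice (f : 'I_d -> T -> R) :
  (forall l w, 0 <= f l w) -> (forall l, measurable_fun setT (f l)) ->
  (forall l (A : set R), measurable A ->
    P (f l @^-1` A `&` b @^-1` [set l]) =
    (P (f l @^-1` A) * P (b @^-1` [set l]))%E) ->
  (\int[P]_w (f (b w) w)%:E =
   (d%:R^-1)%:E * \int[P]_w (\sum_l f l w)%:E)%E.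
Proof.
move=> f0 mf indep.
under eq_integral do rewrite select_sum_indic -sumEFin.
rewrite ge0_integral_sum//; last 2 first.
- move=> l; apply/measurable_EFinP; apply: measurable_funM => //.
- by move=> l w _; rewrite lee_fin mulr_ge0.
under [X in (_ * X)%E]eq_integral do rewrite -sumEFin.
rewrite ge0_integral_sum//; last 2 first.
- by move=> l; apply/measurable_EFinP.
- by move=> l w _; rewrite lee_fin.
rewrite ge0_sume_distrr; last first.
  by move=> l _; apply: integral_ge0 => w _; rewrite lee_fin.
apply: eq_bigr => l _.
rewrite integral_mul_indic_indep//; first by rewrite b_unif.
by move=> B; exact: indep.
Qed.

End UniformChoice.

Section Past.
Variables (R : realType) (disp : measure_display) (T : measurableType disp).
Variables (P : probability T R) (m n d : nat) (A : 'M[R]_(m, n)).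
Variables (tau : 'I_d -> {set 'I_m}) (c : 'cV[R]_n).
Variables (blk : nat -> T -> 'I_d) (msg : nat -> T -> m.-tuple R).
Hypothesis blk_meas : forall k l, measurable (blk k @^-1` [set l]).
Hypothesis msg_meas : forall k, measurable_fun setT (msg k).
Hypothesis indep : mutually_independent P (choice_noise_sigma blk msg).

Local Notation F := (choice_noise_sigma blk msg).

Lemma measurable_blk k (S : set 'I_d) : measurable (blk k @^-1` S).
Proof.
have -> : blk k @^-1` S = \bigcup_(l in S) (blk k @^-1` [set l]).
  apply/seteqP; split => w /= => [Sw|[l Sl bwl]].
    by exists (blk k w).
  by rewrite bwl.
by apply: fin_bigcup_measurable; first exact: finite_finset.
Qed.

Lemma choice_noise_setT i : F i setT.
Proof. by case: i => k; exists setT; rewrite ?setTI ?preimage_setT. Qed.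

Lemma choice_noise_setI i : setI_closed (F i).
Proof.
case: i => k _ _ [B mB <-] [C mC <-]; exists (B `&` C);
  rewrite ?preimage_setI ?setTI//.
exact: measurableI.
Qed.

Lemma choice_noise_measurable i : F i `<=` measurable.
Proof.
case: i => k _ [B mB <-]; first by rewrite setTI; exact: measurable_blk.
exact: msg_meas.
Qed.

Lemma choice_noise_indep (J : {fset nat + nat}) k l B :
  inl k \notin J -> <<s cylinders F J >> B ->
  P (B `&` blk k @^-1` [set l]) = (P B * P (blk k @^-1` [set l]))%E.
Proof.
move=> kJ sB.
apply: (mutually_independent_sigma choice_noise_setT choice_noise_measurable
  choice_noise_setI indep kJ) => //.
by exists [set l]; rewrite ?setTI.
Qed.

Definition past (k : nat) : {fset nat + nat} :=
  ([fset (inl j : nat + nat) | j in iota 0 k] `|`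
   [fset (inr j : nat + nat) | j in iota 0 k])%fset.

Lemma measurable_cylinders_msg (J : {fset nat + nat}) j : inr j \in J ->
  @measurable_col R _ (g_sigma_algebraType (cylinders F J)) m
    (fun w => col_of_tuple (msg j w)).
Proof.
move=> jJ i; under eq_fun do rewrite mxE.
move=> _ B mB; rewrite setTI; apply: sub_sigma_algebra.
apply: (sub_cylinders choice_noise_setT jJ).
exists ((fun t : m.-tuple R => tnth t i) @^-1` B); last by rewrite setTI.
by rewrite -[_ @^-1` _]setTI; exact: measurable_tnth.
Qed.

(** The iterate [k] is measurable for the sigma-algebra of the first [k] steps.
    The hypothesis on [f] is Borel measurability, expressed on the entries of the
    vector. *)
Lemma block_choice_indep_of_past k l (f : 'cV[R]_n -> R) (B : set R) :
  (forall (d' : measure_display) (T' : measurableType d') (X : T' -> 'cV[R]_n),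
    measurable_col X -> measurable_fun setT (f \o X)) ->
  measurable B ->
  let X w := block_gossip A (fun j => tau (blk j w))
    (fun j => col_of_tuple (msg j w)) c k in
  P ((f \o X) @^-1` B `&` blk k @^-1` [set l]) =
  (P ((f \o X) @^-1` B) * P (blk k @^-1` [set l]))%E.
Proof.
move=> mf mB X; apply: (@choice_noise_indep (past k)).
  rewrite !inE negb_or; apply/andP; split; apply/imfsetP => -[j].
    by rewrite /= mem_iota => jk [kj]; rewrite kj ltnn andbF in jk.
  by [].
have mX : @measurable_col R _ (g_sigma_algebraType (cylinders F (past k))) n X.
  apply: (@measurable_block_gossip R _
    (g_sigma_algebraType (cylinders F (past k)))).
    move=> j l' jk; apply: sub_sigma_algebra.
    apply: (@sub_cylinders _ _ _ _ choice_noise_setT _ (inl j)).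
      by rewrite !inE; apply/orP; left; apply/imfsetP; exists j;
        rewrite //= mem_iota.
    by exists [set l']; rewrite ?setTI.
  move=> j jk; apply: measurable_cylinders_msg.
  by rewrite !inE; apply/orP; right; apply/imfsetP; exists j;
    rewrite //= mem_iota.
by have := mf _ _ _ mX measurableT _ mB; rewrite setTI.
Qed.

Lemma block_choice_indep_of_noise k l (f : 'cV[R]_m -> R) (B : set R) :
  (forall (d' : measure_display) (T' : measurableType d') (X : T' -> 'cV[R]_m),
    measurable_col X -> measurable_fun setT (f \o X)) ->
  measurable B ->
  let X w := col_of_tuple (msg k w) in
  P ((f \o X) @^-1` B `&` blk k @^-1` [set l]) =
  (P ((f \o X) @^-1` B) * P (blk k @^-1` [set l]))%E.
Proof.
move=> mf mB X; apply: (@choice_noise_indep [fset inr k]%fset).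
  by rewrite !inE.
have mX : @measurable_col R _
    (g_sigma_algebraType (cylinders F [fset inr k]%fset)) m X.
  by apply: measurable_cylinders_msg; rewrite inE.
by have := mf _ _ _ mX measurableT _ mB; rewrite setTI.
Qed.

End Past.

(** * Expected error *)

Lemma sqr_norm2 (R : realType) n (x : 'cV[R]_n) : norm2 x ^+ 2 = dot x x.
Proof.
by rewrite /norm2 dotxx sqr_sqrtr// sumr_ge0// => i _; rewrite sqr_ge0.
Qed.

(** The horizon [C = t / s] is the fixed point of [v |-> (1 - s) v + t].  The
    recurrence is in the extended reals and has no subtraction; finiteness of
    [a k] is part of what the induction proves. *)
Lemma affine_contraction (R : realType) (a : nat -> \bar R) (s t C v0 : R) :
  0 <= 1 - s -> 0 <= C -> t = s * C -> (a 0%N <= v0%:E)%E ->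
  (forall k, (0 <= a k)%E) ->
  (forall k, (a k.+1 + s%:E * a k <= a k + t%:E)%E) ->
  forall k, (a k <= ((1 - s) ^+ k * v0 + C)%:E)%E.
Proof.
move=> s1 C0 -> a0 age0 step; elim=> [|k IHk].
  by rewrite expr0 mul1r (le_trans a0)// lee_fin lerDl.
have := step k; have := age0 k; have := age0 k.+1.
case: (a k) IHk => [v|//|//]; rewrite lee_fin => IHk.
case: (a k.+1) => [v'|//|//]; rewrite -EFinM -!EFinD !lee_fin => _ _ v'le.
have := ler_wpM2l s1 IHk; rewrite exprS; lra.
Qed.

Lemma ge0_integralZ_fin (R : realType) (disp : measure_display)
    (T : measurableType disp) (P : {measure set T -> \bar R})
    (x : R) (h : T -> R) :
  0 <= x -> measurable_fun setT h -> (forall w, 0 <= h w) ->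
  (\int[P]_w (x * h w)%:E = x%:E * \int[P]_w (h w)%:E)%E.
Proof.
move=> x0 mh h0; under eq_integral do rewrite EFinM.
rewrite ge0_integralZl_EFin//; first by move=> w _; rewrite lee_fin.
exact/measurable_EFinP.
Qed.

Section Main.
Variables (R : realType) (m n : nat) (G : graph m n) (Q : 'M[R]_(m, n)).
Variables (d : nat) (alpha beta : R) (rmin rmax : nat).
Variable (tau : 'I_d -> {set 'I_m}).
Hypotheses (hG : connected_graph G) (hQ : incidence_matrix G Q).
Hypothesis hT : row_covering Q alpha beta rmin rmax tau.
Hypothesis halpha : 0 < alpha.
Hypothesis n2 : (1 < n)%N.
Variables (c : 'cV[R]_n) (disp : measure_display) (T : measurableType disp).
Variables (P : probability T R) (blk : nat -> T -> 'I_d).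
Hypothesis blk_meas : forall k l, measurable (blk k @^-1` [set l]).
Hypothesis blk_unif : forall k l, P (blk k @^-1` [set l]) = (d%:R^-1)%:E.
Variable msg : nat -> {RV P >-> m.-tuple R}.
Hypothesis indep :
  mutually_independent P (choice_noise_sigma blk (fun k w => msg k w)).
Variable Sigma : 'M[R]_m.
Hypothesis msg_sq : forall k i,
  (\int[P]_w (tnth (msg k w) i ^+ 2)%:E = (Sigma i i)%:E)%E.

Let noise k w := col_of_tuple (msg k w).
Let error k w :=
  block_gossip Q (fun j => tau (blk j w)) (fun j => noise j w) c k -
  mean_vector c.

Let measurable_noise k : measurable_col (noise k).
Proof.
move=> i; under eq_fun do rewrite mxE.
apply: (measurableT_comp (measurable_tnth i)); exact: measurable_funP.
Qed.

Let measurable_error k : measurable_col (error k).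
Proof.
apply: measurable_colD; last exact: measurable_col_cst.
exact: measurable_block_gossip.
Qed.

Let Q_mean : Q *m mean_vector c = 0.
Proof. exact: (incidence_mul_const hQ). Qed.

(** The vector 1 is in the kernel of every block, and each step preserves the
    inner product with it. *)
Lemma dot_one_error k w : dot (const_mx 1) (error k w) = 0.
Proof.
have [b0 _ _] := covering_params_gt0 hG hQ hT n2.
elim: k => [|k <-]; last first.
  apply: (gossip_step_le hT (blk k w) _ _ halpha b0 Q_mean).2.
  exact: (incidence_mul_const hQ).
rewrite dotE; under eq_bigr do rewrite !mxE mul1r.
rewrite sumrB sumr_const card_ord -[X in _ - X]mulr_natr divfK ?subrr//.
by rewrite pnatr_eq0 -lt0n ltnW.
Qed.

Let V k := (\int[P]_w (dot (error k w) (error k w))%:E)%E.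

Lemma trace_ge0 : 0 <= \tr Sigma.
Proof.
apply: sumr_ge0 => i _; rewrite -lee_fin -(msg_sq 0 i).
by apply: integral_ge0 => w _; rewrite lee_fin sqr_ge0.
Qed.

Lemma integral_block_sq_error k :
  ((d%:R^-1 * (rmin%:R * algebraic_connectivity Q))%:E * V k <=
   \int[P]_w (block_sq (tau (blk k w)) (Q *m error k w))%:E)%E.
Proof.
have [b0 d0 r0] := covering_params_gt0 hG hQ hT n2.
have L0 := algebraic_connectivity_gt0 hQ hG n2.
have msq l : measurable_fun setT (fun w => block_sq (tau l) (Q *m error k w)).
  by apply: measurable_block_sq; exact: measurable_col_mul.
rewrite (@integral_uniform_choice _ _ _ P _ _ (blk_meas k) (blk_unif k)
  (fun l w => block_sq (tau l) (Q *m error k w)))//.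
- rewrite EFinM -muleA lee_pmul2l//; last by rewrite lte_fin invr_gt0 ltr0n.
  rewrite /V -ge0_integralZ_fin//; last 3 first.
  + by rewrite mulr_ge0// ltW.
  + exact: measurable_dot.
  + by move=> w; exact: dot_ge0.
  apply: ge0_le_integral => //.
  + by move=> w _; rewrite lee_fin mulr_ge0 ?dot_ge0// mulr_ge0// ltW.
  + apply/measurable_EFinP; apply: measurable_funM; last exact: measurable_dot.
    exact: measurable_cst.
  + by apply/measurable_EFinP; exact: measurable_sum.
  + move=> w _; rewrite lee_fin -mulrA (le_trans _ (sum_block_sq_ge hT _))//.
    rewrite ler_wpM2l// (algebraic_connectivity_le hQ)//.
    exact: dot_one_error.
- by move=> l w; exact: block_sq_ge0.
- move=> l B mB.
  apply: (block_choice_indep_of_past Q tau c blk_meas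
    (fun j => measurable_funP (msg j)) indep k l
    (f := fun x => block_sq (tau l) (Q *m (x - mean_vector c)))) => //.
  move=> d' T' X mX; apply: measurable_block_sq; apply: measurable_col_mul.
  by apply: measurable_colD => //; exact: measurable_col_cst.
Qed.

Lemma integral_block_sq_noise k :
  (\int[P]_w (block_sq (tau (blk k w)) (noise k w))%:E <=
   (d%:R^-1 * (rmax%:R * \tr Sigma))%:E)%E.
Proof.
have [b0 d0 r0] := covering_params_gt0 hG hQ hT n2.
have msq l : measurable_fun setT (fun w => block_sq (tau l) (noise k w)).
  exact: measurable_block_sq.
rewrite (@integral_uniform_choice _ _ _ P _ _ (blk_meas k) (blk_unif k)
  (fun l w => block_sq (tau l) (noise k w)))//.
- rewrite EFinM lee_pmul2l//; last by rewrite lte_fin invr_gt0 ltr0n.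
  have -> : ((rmax%:R * \tr Sigma)%:E =
      \int[P]_w (rmax%:R * \sum_i tnth (msg k w) i ^+ 2)%:E)%E.
    rewrite ge0_integralZ_fin//; last 2 first.
    + apply: measurable_sum => i; apply: measurable_funX.
      by have := measurable_noise k i; under eq_fun do rewrite mxE.
    + by move=> w; apply: sumr_ge0 => i _; exact: sqr_ge0.
    rewrite EFinM; congr (_ * _)%E.
    under eq_integral do rewrite -sumEFin.
    rewrite ge0_integral_sum//; last 2 first.
    + move=> i; apply/measurable_EFinP/measurable_funX.
      by have := measurable_noise k i; under eq_fun do rewrite mxE.
    + by move=> i w _; rewrite lee_fin sqr_ge0.
    rewrite -sumEFin; apply: eq_bigr => i _.
    by rewrite msg_sq.
  apply: ge0_le_integral => //.
  + by move=> w _; rewrite lee_fin sumr_ge0// => l _; exact: block_sq_ge0.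
  + by apply/measurable_EFinP; exact: measurable_sum.
  + apply/measurable_EFinP; apply: measurable_funM; first exact: measurable_cst.
    apply: measurable_sum => i; apply: measurable_funX.
    by have := measurable_noise k i; under eq_fun do rewrite mxE.
  + move=> w _; rewrite lee_fin.
    apply: le_trans (sum_block_weight_le hT _); last first.
      by move=> i; exact: sqr_ge0.
    apply: ler_sum => l _; apply: ler_sum => i _.
    by rewrite mxE.
- by move=> l w; exact: block_sq_ge0.
- move=> l B mB.
  apply: (block_choice_indep_of_noise blk_meas
    (fun j => measurable_funP (msg j)) indep k l (f := block_sq (tau l))) => //.
  by move=> d' T' X mX; exact: measurable_block_sq.
Qed.

(** The contraction term is kept on the left, because the finiteness of [V k] is
    only established afterwards, by induction along this recurrence. *)
Lemma expected_error_step k :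
  (V k.+1 + (rmin%:R * algebraic_connectivity Q / (beta * d%:R))%:E * V k <=
   V k + (rmax%:R * \tr Sigma / (alpha * d%:R))%:E)%E.
Proof.
set s := _ / (beta * _); set t := _ / (alpha * _).
have [b0 d0 r0] := covering_params_gt0 hG hQ hT n2.
have d0' : d%:R != 0 :> R by rewrite pnatr_eq0 -lt0n.
have mQ : measurable_fun setT
    (fun w => block_sq (tau (blk k w)) (Q *m error k w)).
  apply: (measurable_select (f := fun l w => block_sq (tau l) (Q *m error k w))) => //.
  by move=> l; apply: measurable_block_sq; exact: measurable_col_mul.
have mN : measurable_fun setT (fun w => block_sq (tau (blk k w)) (noise k w)).
  apply: (measurable_select (f := fun l w => block_sq (tau l) (noise k w))) => //.
  by move=> l; exact: measurable_block_sq.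
have mE j : measurable_fun setT (fun w => dot (error j w) (error j w)).
  exact: measurable_dot.
have sE : s = beta^-1 * (d%:R^-1 * (rmin%:R * algebraic_connectivity Q)).
  by rewrite /s; field; rewrite d0' gt_eqF.
have tE : t = alpha^-1 * (d%:R^-1 * (rmax%:R * \tr Sigma)).
  by rewrite /t; field; rewrite d0' gt_eqF.
have pos (x : R) (h : T -> R) : 0 < x -> (forall w, 0 <= h w) ->
    forall w, [set: T] w -> (0 <= (x * h w)%:E)%E.
  by move=> x0 h0 w _; rewrite lee_fin mulr_ge0// ltW.
apply: (@le_trans _ _ (\int[P]_w (dot (error k.+1 w) (error k.+1 w))%:E +
    \int[P]_w (beta^-1 * block_sq (tau (blk k w)) (Q *m error k w))%:E)%E).
  rewrite leeD2l// ge0_integralZ_fin ?invr_ge0 ?(ltW b0)//; last first.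
    by move=> w; exact: block_sq_ge0.
  rewrite sE EFinM -muleA lee_pmul2l//; last by rewrite lte_fin invr_gt0.
  exact: integral_block_sq_error.
rewrite -ge0_integralD//; last 4 first.
- by move=> w _; rewrite lee_fin dot_ge0.
- exact/measurable_EFinP.
- by apply: pos => [|w]; rewrite ?invr_gt0 ?block_sq_ge0.
- by apply/measurable_EFinP; apply: measurable_funM => //; exact: measurable_cst.
apply: (@le_trans _ _ (\int[P]_w (dot (error k w) (error k w))%:E +
    \int[P]_w (alpha^-1 * block_sq (tau (blk k w)) (noise k w))%:E)%E).
  rewrite -ge0_integralD//; last 4 first.
  - by move=> w _; rewrite lee_fin dot_ge0.
  - exact/measurable_EFinP.
  - by apply: pos => [|w]; rewrite ?invr_gt0 ?block_sq_ge0.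
  - by apply/measurable_EFinP; apply: measurable_funM => //; exact: measurable_cst.
  apply: ge0_le_integral => //.
  - move=> w _; rewrite -EFinD lee_fin addr_ge0 ?dot_ge0// mulr_ge0//.
      by rewrite invr_ge0 ltW.
    exact: block_sq_ge0.
  - apply/measurable_EFinP; apply: measurable_funD => //.
    by apply: measurable_funM => //; exact: measurable_cst.
  - apply/measurable_EFinP; apply: measurable_funD => //.
    by apply: measurable_funM => //; exact: measurable_cst.
  - move=> w _; rewrite -!EFinD lee_fin.
    exact: (gossip_step_le hT (blk k w) _ _ halpha b0 Q_mean).1.
rewrite leeD2l// ge0_integralZ_fin ?invr_ge0 ?(ltW halpha)//; last first.
  by move=> w; exact: block_sq_ge0.
rewrite tE EFinM lee_pmul2l//; last by rewrite lte_fin invr_gt0.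
exact: integral_block_sq_noise.
Qed.

Theorem expected_error_le k :
  (\int[P]_w (norm2 (error k w) ^+ 2)%:E <=
   ((1 - rmin%:R * algebraic_connectivity Q / (beta * d%:R)) ^+ k *
      norm2 (c - mean_vector c) ^+ 2 +
    beta * rmax%:R / (alpha * rmin%:R * algebraic_connectivity Q) *
      \tr Sigma)%:E)%E.
Proof.
have [b0 d0 r0] := covering_params_gt0 hG hQ hT n2.
have L0 := algebraic_connectivity_gt0 hQ hG n2.
under eq_integral do rewrite sqr_norm2; rewrite sqr_norm2.
apply: (affine_contraction (a := V) _ _ _ _ _ expected_error_step).
- by have /andP[] := rate_bounds hG hQ hT n2.
- rewrite mulr_ge0 ?trace_ge0// divr_ge0 ?mulr_ge0 ?ler0n// ltW//.
- field; rewrite !gt_eqF// ?ltr0n//.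
- rewrite -[V 0]/(\int[P]_w
    (cst (dot (c - mean_vector c) (c - mean_vector c))%:E w))%E.
  by rewrite integral_cst// (_ : _ setT = 1%E) ?mule1//; exact: probability_setT.
- by move=> j; apply: integral_ge0 => w _; rewrite lee_fin dot_ge0.
Qed.

End Main.

Lemma block_gossip_no_edge (R : realType) n (Q : 'M[R]_(0, n)) b mu c k :
  block_gossip Q b mu c k = c.
Proof.
elim: k => //= k ->; rewrite /gossip_step.
set y := (_ - _ *m c); have -> : y = 0.
  by apply/colP => i; have [] := enum_val i.
by rewrite mulmx0 addr0.
Qed.

Lemma mean_vector_one_node (R : realType) n (c : 'cV[R]_n) : (n <= 1)%N ->
  mean_vector c = c.
Proof.
case: n c => [|[|//]] c _; first by apply/colP => -[].
by apply/colP => i; rewrite mxE big_ord1 divr1 !ord1.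
Qed.

Theorem corollary4p3 (R : realType)
  (m n : nat) (G : graph m n) (hG : connected_graph G)
  (Q : 'M[R]_(m, n)) (hQ : incidence_matrix G Q)
  (d : nat) (alpha beta : R) (rmin rmax : nat) (tau : 'I_d -> {set 'I_m})
  (hT : row_covering Q alpha beta rmin rmax tau) (halpha : 0 < alpha)
  (c : 'cV[R]_n)
  (disp : measure_display) (Omega : measurableType disp)
  (P : probability Omega R)
  (blk : nat -> Omega -> 'I_d)
  (blk_meas : forall k l, measurable (blk k @^-1` [set l]))
  (blk_unif : forall k l, P (blk k @^-1` [set l]) = (d%:R^-1)%:E)
  (D : probability (m.-tuple R) R) (Sigma : 'M[R]_m)
  (D_mean : forall i, ('E_D[fun x => tnth x i] = 0)%E)
  (D_cov : forall i j, ('E_D[fun x => (tnth x i * tnth x j)%R] = (Sigma i j)%:E)%E)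
  (msg : nat -> {RV P >-> m.-tuple R})
  (msg_law : forall k (A : set (m.-tuple R)), measurable A ->
     distribution P (msg k) A = D A)
  (indep : mutually_independent P
     (choice_noise_sigma blk (fun k w => msg k w))) :
  let rate := 1 - rmin%:R * algebraic_connectivity Q / (beta * d%:R) in
  let iterate k w :=
    block_gossip Q (fun j => tau (blk j w)) (fun j => col_of_tuple (msg j w)) c k in
  ((1 < n)%N -> 0 <= rate < 1) /\
  forall k : nat,
    ('E_P[fun w => (norm2 (iterate k w - mean_vector c) ^+ 2)%R] <=
     (rate ^+ k * norm2 (c - mean_vector c) ^+ 2 +
      beta * rmax%:R / (alpha * rmin%:R * algebraic_connectivity Q) *
        \tr Sigma)%:E)%E.
Proof.
move=> rate iterate; split=> [n2|k]; first exact: (rate_bounds hG hQ hT n2).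
rewrite unlock; case: (ltnP 1 n) => [n2|n1].
  apply: (expected_error_le hG hQ hT) => // j i.
  have := D_cov i i; rewrite unlock => <-.
  rewrite (eq_measure_integral (distribution P (msg j))); last first.
    by move=> A mA _; apply/esym; exact: msg_law.
  rewrite ge0_integral_distribution//=.
  - by apply/measurable_EFinP; apply: measurable_funM; exact: measurable_tnth.
  - by move=> x; rewrite lee_fin -expr2 sqr_ge0.
have m0 := no_edge_on_one_node G n1; subst m.
have -> : (\int[P]_w (norm2 (iterate k w - mean_vector c) ^+ 2)%:E = 0)%E.
  apply: integral0_eq => w _.
  rewrite /iterate block_gossip_no_edge mean_vector_one_node// subrr.
  by rewrite sqr_norm2 dot0l.
rewrite mean_vector_one_node// subrr sqr_norm2 dot0l mulr0 add0r.
by rewrite /mxtrace big_ord0 mulr0.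
Qed.
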